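(* Let $n\geq 1$ be an integer, let $f\in\mathcal{A}_n$, let $\alpha$ be a real number with $0\leq\alpha<1$, and let $\beta$ be a complex number with $\mathrm{Re}(\beta)<n+1$. If $$\left|zf''(z)-\beta\left(f'(z)-\frac{f(z)}{z}\right)\right|<\frac{(1-\alpha)\,n\,|n+1-\beta|}{n+1-\alpha}\qquad\text{for all } z\in\mathbb{U},$$ then $$\left|\frac{zf'(z)}{f(z)}-1\right|<1-\alpha\qquad\text{for all } z\in\mathbb{U},$$ so that $f\in\mathcal{S}^{*}(\alpha)$.
   Context: $\mathbb{U}=\{z\in\mathbb{C}:|z|<1\}$ is the open unit disk. For an integer $n\geq1$, $\mathcal{A}_n$ is the class of functions $f$ analytic in $\mathbb{U}$ with power series of the form $f(z)=z+a_{n+1}z^{n+1}+a_{n+2}z^{n+2}+\cdots$. For $0\leq\alpha<1$, $\mathcal{S}^{*}(\alpha)$ is the class of $f\in\mathcal{A}_n$ such that $\mathrm{Re}\left(\frac{zf'(z)}{f(z)}\right)>\alpha$ for all $z\in\mathbb{U}$. At $z=0$ the quotients $f(z)/z$ and $zf'(z)/f(z)$ are understood by their analytic continuation (removable singularity), both with value $1$. Inequalities involving a quotient include the assertion that the quotient is defined, i.e. here that $f(z)\neq0$ for $z\in\mathbb{U}\setminus\{0\}$. *)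

(* Defs.v *)
(* Stdlib reals with Coquelicot's complex numbers. *)
From Stdlib Require Import Reals.
From Coquelicot Require Import Coquelicot.

Local Open Scope R_scope.

(* Functions on the unit disk are represented by total functions C -> C; only
   their values on [in_disk] matter, since the disk is open and [C_derive] is
   local. *)
Definition in_disk (z : C) : Prop := Cmod z < 1.

Definition analytic_on_disk (f : C -> C) : Prop :=
  forall z : C, in_disk z -> ex_derive f z.

(* f(z) = z + a_(n+1) z^(n+1) + a_(n+2) z^(n+2) + ... on the whole disk. *)
Definition class_A (n : nat) (f : C -> C) : Prop :=
  analytic_on_disk f /\
  exists a : nat -> C,
    a 0%nat = RtoC 0 /\ a 1%nat = RtoC 1 /\
    (forall k : nat, (2 <= k <= n)%nat -> a k = RtoC 0) /\
    (forall z : C, in_disk z -> is_pseries a z (f z)).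

(* f(z)/z and z f'(z)/f(z), with the removable singularity at 0 filled in:
   for f in [class_A n] with n >= 1 both continuations take the value 1. *)
Definition quot_id (f : C -> C) (z : C) : C :=
  if Ceq_dec z (RtoC 0) then RtoC 1 else (f z / z)%C.

Definition quot_log (f : C -> C) (z : C) : C :=
  if Ceq_dec z (RtoC 0) then RtoC 1 else (z * C_derive f z / f z)%C.

(* Division is total in C, so that [quot_log f] is a genuine quotient on the
   disk has to be said separately. *)
Definition quot_log_defined (f : C -> C) : Prop :=
  forall z : C, in_disk z -> z <> RtoC 0 -> f z <> RtoC 0.

Definition starlike (n : nat) (alpha : R) (f : C -> C) : Prop :=
  class_A n f /\
  quot_log_defined f /\
  forall z : C, in_disk z -> alpha < Re (quot_log f z).

(* Main.v *)
Require Import Defs.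
From Stdlib Require Import Reals Lra Lia List ClassicalEpsilon.
From Coquelicot Require Import Coquelicot.
Local Open Scope R_scope.

(** Why the theorem holds.  Factor the power series as f = z F with
    F = 1 + z^n G, and put q = n G + z G'.  Then f' - f/z = z F' = z^n q and, with
    c = n + 1 - beta,
      z f'' - beta (f' - f/z) = z^n (z q' + c q),   Re c > 0.

    The heart is an estimate for first-order operators
    ([Cmod_bound_of_first_order]): if Re c > 0 and |z|^n |z q' + c q| <= M on the
    disk, then |c| |q| <= M on the disk.  Where |q| is maximal on |z| <= r, moving
    from z0 in the inward direction - conj(c) z0 cannot increase |q|; this says
    Re (conj(c q) z0 q') >= 0, whence |z0 q' + c q| >= |c| |q| at z0.  To divide by
    the weight |z0|^n one needs |z0| = r, which is a maximum principle: the function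
    |q|^2 + eps |z|^2 has positive Laplacian, so its maximum on the closed disk lies
    on the circle ([penalized_max_on_circle]).  Let eps tend to 0 and r to 1.

    Applied to (q, c), the estimate turns the hypothesis into
    |q| <= N = (1 - alpha) n / (n + 1 - alpha).  Applied to (G, n), where
    n G + z G' = q, it gives |G| <= N / n.  Hence |F| > 1 - N / n =
    n / (n + 1 - alpha) on the disk, so f vanishes only at 0, and
    |z f'/f - 1| = |z^n q| / |F| < 1 - alpha ([quotient_bound]).

    The calculus above needs G to be three times differentiable, which comes from
    termwise differentiation of complex power series ([is_derive_expands]). *)

(** * Complex derivatives *)

Lemma is_derive_C_eps (f : C -> C) (z l : C) :
  is_derive f z l <->
  forall eps : posreal, exists delta : posreal, forall w : C,
    Cmod (w - z)%C < delta ->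
    Cmod (f w - f z - (w - z) * l)%C <= eps * Cmod (w - z)%C.
Proof.
split.
- intros [_ H] eps.
  destruct (H z (fun P HP => HP) eps) as [d Hd].
  exists d; intros w Hw; exact (Hd w Hw).
- intros H; split.
  + exact (is_linear_scal_l l).
  + intros z' Hz eps.
    rewrite <- (is_filter_lim_locally_unique _ _ Hz).
    destruct (H eps) as [d Hd]; exists d; intros w Hw; exact (Hd w Hw).
Qed.

(** The field C carries two normed-module structures over itself, which differ
    only in their uniform balls.  General rules for products and for the identity
    speak of one of them and derivatives of complex functions of the other; this
    bridges the two. *)
Lemma is_derive_C_ring (f : C -> C) (z l : C) :
  is_derive (V := AbsRing_NormedModule C_AbsRing) f z l <-> is_derive f z l.
Proof.
split; intros [_ H]; (split; [apply is_linear_scal_l | exact H]).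
Qed.

Lemma is_derive_Cmult (f g : C -> C) (z df dg : C) :
  is_derive f z df -> is_derive g z dg ->
  is_derive (fun w => f w * g w)%C z (df * g z + f z * dg)%C.
Proof.
rewrite <- !is_derive_C_ring; intros Hf Hg.
exact (is_derive_mult (K := C_AbsRing) f g z df dg Hf Hg Cmult_comm).
Qed.

Lemma is_derive_Cplus (f g : C -> C) (z df dg : C) :
  is_derive f z df -> is_derive g z dg ->
  is_derive (fun w => f w + g w)%C z (df + dg)%C.
Proof. exact (is_derive_plus (V := C_NormedModule) f g z df dg). Qed.

Lemma is_derive_Cconst (c z : C) : is_derive (fun _ : C => c) z (RtoC 0).
Proof. exact (is_derive_const (V := C_NormedModule) c z). Qed.

Lemma is_derive_Cid (z : C) : is_derive (fun w : C => w) z (RtoC 1).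
Proof. apply is_derive_C_ring; exact (is_derive_id (K := C_AbsRing) z). Qed.

Lemma is_derive_Cpow (n : nat) (z : C) :
  is_derive (fun w : C => w ^ n)%C z (RtoC (INR n) * z ^ (pred n))%C.
Proof.
induction n as [|n IH].
- replace (RtoC (INR 0) * z ^ (pred 0))%C with (RtoC 0) by (simpl; ring).
  exact (is_derive_Cconst 1 z).
- replace (RtoC (INR (S n)) * z ^ pred (S n))%C
    with (RtoC 1 * z ^ n + z * (RtoC (INR n) * z ^ pred n))%C.
  + exact (is_derive_Cmult (fun w => w) (fun w => w ^ n)%C z _ _ (is_derive_Cid z) IH).
  + rewrite S_INR, RtoC_plus. destruct n; simpl pred; [simpl; ring|].
    rewrite (Cpow_S z n). ring.
Qed.

Lemma is_derive_C_ext_disk (f g : C -> C) (z l : C) :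
  in_disk z -> (forall w, in_disk w -> f w = g w) ->
  is_derive f z l -> is_derive g z l.
Proof.
intros Hz Heq Hf; apply is_derive_C_eps; intros eps.
destruct (proj1 (is_derive_C_eps f z l) Hf eps) as [d Hd].
assert (H0 : 0 < Rmin d (1 - Cmod z)).
{ apply Rmin_glb_lt; [apply cond_pos | unfold in_disk in Hz; lra]. }
exists (mkposreal _ H0); intros w Hw; simpl in Hw.
rewrite <- !Heq; trivial.
- apply Hd; eapply Rlt_le_trans; [exact Hw | apply Rmin_l].
- unfold in_disk. replace w with ((w - z) + z)%C by ring.
  eapply Rle_lt_trans; [apply Cmod_triangle|].
  pose proof (Rmin_r d (1 - Cmod z)); lra.
Qed.

(** Restricting to a real line turns questions on the modulus of a complex
    function into one-variable real calculus. *)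
Lemma derivable_along_line (f : C -> C) (z0 d l : C) (t0 : R) :
  is_derive f (z0 + t0 * d)%C l ->
  is_derive (fun t : R => Re (f (z0 + t * d)%C)) t0 (Re (l * d)%C).
Proof.
intros Hf; apply is_derive_Reals; intros eps Heps.
assert (Hm : 0 < Cmod d + 1) by (pose proof (Cmod_ge_0 d); lra).
(* Dividing by |d| + 1 keeps the tolerance meaningful when d = 0, and the
   factor 1/2 turns the non-strict complex estimate into a strict one. *)
assert (He : 0 < eps / (Cmod d + 1) / 2).
{ apply Rdiv_lt_0_compat; [apply Rdiv_lt_0_compat; lra | lra]. }
destruct (proj1 (is_derive_C_eps f _ l) Hf (mkposreal _ He)) as [dl Hd].
simpl in Hd.
assert (Hdl : 0 < dl / (Cmod d + 1)) by (apply Rdiv_lt_0_compat; [apply cond_pos|lra]).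
exists (mkposreal _ Hdl); intros h Hh Hhd; simpl in Hhd.
set (w := (z0 + (t0 + h)%R * d)%C).
assert (Hw : (w - (z0 + t0 * d) = h * d)%C) by (unfold w; rewrite RtoC_plus; ring).
assert (Hah : 0 < Rabs h) by now apply Rabs_pos_lt.
specialize (Hd w); rewrite Hw, Cmod_mult, Cmod_R in Hd.
assert (Hlt : Rabs h * Cmod d < dl).
{ apply Rle_lt_trans with (Rabs h * (Cmod d + 1)); [nra|].
  apply Rmult_lt_reg_r with (/ (Cmod d + 1)); [now apply Rinv_0_lt_compat|].
  rewrite Rmult_assoc, Rinv_r, Rmult_1_r by lra; exact Hhd. }
specialize (Hd Hlt).
replace ((Re (f w) - Re (f (z0 + t0 * d)%C)) / h - Re (l * d)%C)
  with (Re (f w - f (z0 + t0 * d) - h * d * l)%C / h).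
2:{ unfold Cminus; rewrite !re_plus, !re_opp.
    replace (h * d * l)%C with (h * (l * d))%C by ring.
    rewrite re_scal_l; field; assumption. }
unfold Rdiv; rewrite Rabs_mult, Rabs_inv.
apply Rmult_lt_reg_r with (Rabs h); trivial.
rewrite Rmult_assoc, Rinv_l, Rmult_1_r by lra.
eapply Rle_lt_trans; [apply re_le_Cmod|].
eapply Rle_lt_trans; [apply Hd|].
replace (eps / (Cmod d + 1) / 2 * (Rabs h * Cmod d))
  with (eps * Rabs h * (Cmod d / (Cmod d + 1) / 2)) by (field; lra).
assert (Cmod d / (Cmod d + 1) <= 1).
{ apply Rmult_le_reg_r with (Cmod d + 1); trivial.
  unfold Rdiv; rewrite Rmult_assoc, Rinv_l by lra; lra. }
assert (0 < eps * Rabs h) by (apply Rmult_lt_0_compat; lra).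
nra.
Qed.

(** * Maxima of continuous functions on a closed disk *)

Notation continuousC Phi z :=
  (continuous (T := AbsRing_UniformSpace C_AbsRing) (U := R_UniformSpace) Phi z).

(** If no point were a maximum, each point of the disk would have a neighbourhood
    on which Phi stays below its value at some better point of the disk.  Finitely
    many of these neighbourhoods cover the disk, and the best of the corresponding
    better points beats itself. *)
Lemma max_on_closed_disk (Phi : C -> R) (r : R) :
  0 <= r ->
  (forall z : C, Cmod z <= r -> continuousC Phi z) ->
  exists z0 : C, Cmod z0 <= r /\ forall z : C, Cmod z <= r -> Phi z <= Phi z0.
Proof.
intros Hr Hc; apply NNPP; intros Hno.
assert (Hbetter : forall t : C, exists p : posreal * C,
  Cmod (snd p) <= r /\
  forall w : C, Cmod (w - t)%C < 2 * fst p -> Cmod w <= r -> Phi w < Phi (snd p)).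
{ intros t; destruct (Rle_lt_dec (Cmod t) r) as [Ht|Ht].
  - assert (Hex : exists z', Cmod z' <= r /\ Phi t < Phi z').
    { apply NNPP; intros Hn; apply Hno; exists t; split; trivial.
      intros z Hz; apply Rnot_lt_le; intros Hlt; apply Hn; now exists z. }
    destruct Hex as [z' [Hz' Hlt]].
    assert (Hgap : 0 < Phi z' - Phi t) by lra.
    destruct (proj1 (filterlim_locally _ _) (Hc t Ht) (mkposreal _ Hgap)) as [d Hd].
    exists (mkposreal _ (is_pos_div_2 d), z'); split; trivial; simpl.
    intros w Hw _.
    assert (Hb : Rabs (Phi w - Phi t) < Phi z' - Phi t).
    { apply (Hd w); change (Cmod (w - t)%C < d); lra. }
    apply Rabs_def2 in Hb; lra.
  - (* This neighbourhood misses the disk, so the value 0 below is a dummy. *)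
    assert (Hgap : 0 < (Cmod t - r) / 2) by lra.
    exists (mkposreal _ Hgap, RtoC 0); simpl; split; [now rewrite Cmod_0|].
    intros w Hw Hwr; exfalso.
    assert (Htri := Cmod_triangle (t - w)%C w).
    replace (t - w + w)%C with t in Htri by ring.
    replace (t - w)%C with (- (w - t))%C in Htri by ring.
    rewrite Cmod_opp in Htri; lra. }
pose (p := fun t : C => proj1_sig (constructive_indefinite_description _ (Hbetter t))).
assert (Hp : forall t, Cmod (snd (p t)) <= r /\
  forall w : C, Cmod (w - t)%C < 2 * fst (p t) -> Cmod w <= r -> Phi w < Phi (snd (p t))).
{ intros t; exact (proj2_sig (constructive_indefinite_description _ (Hbetter t))). }
clearbody p.
pose (pt := fun x : Compactness.Tn 2 R => (fst x, fst (snd x)) : C).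
apply (compactness_list 2 (- r, (- r, tt)) (r, (r, tt)) (fun x => fst (p (pt x)))).
intros [l Hl].
assert (Hmax : exists z0 : C, Cmod z0 <= r /\
  forall t, In t l -> Phi (snd (p (pt t))) <= Phi z0).
{ clear Hl; induction l as [|x l [z0 [Hz0 IH]]].
  - exists (RtoC 0); rewrite Cmod_0; split; trivial; intros t [].
  - destruct (Rle_lt_dec (Phi (snd (p (pt x)))) (Phi z0)) as [Hx|Hx].
    + exists z0; split; trivial; intros t [<-|Ht]; auto.
    + exists (snd (p (pt x))); split; [apply Hp|].
      intros t [<-|Ht]; [lra|]; specialize (IH t Ht); lra. }
destruct Hmax as [[x y] [Hz0 Hmax]].
assert (Hxy := Rmax_Cmod (x, y)); simpl in Hxy.
assert (Hx : - r <= x <= r).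
{ apply Rabs_le_between; pose proof (Rmax_l (Rabs x) (Rabs y)); lra. }
assert (Hy : - r <= y <= r).
{ apply Rabs_le_between; pose proof (Rmax_r (Rabs x) (Rabs y)); lra. }
destruct (Hl (x, (y, tt))) as [[u [v []]] [Hin [_ [Hu [Hv _]]]]].
{ simpl; tauto. }
specialize (Hmax _ Hin); simpl in Hu, Hv.
refine (Rlt_not_le _ _ (proj2 (Hp (pt (u, (v, tt)))) (x, y) _ Hz0) Hmax).
eapply Rle_lt_trans; [apply Cmod_2Rmax|].
change (sqrt 2 * Rmax (Rabs (x - u)) (Rabs (y - v)) < 2 * fst (p (pt (u, (v, tt))))).
assert (Hm := Rmax_lub_lt _ _ _ Hu Hv).
(* The cover is by squares; this is where the factor 2 in Hbetter pays. *)
assert (H2 : 0 <= sqrt 2 < 2).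
{ split; [apply sqrt_pos|].
  rewrite <- (sqrt_square 2) at 2 by lra; apply sqrt_lt_1; lra. }
assert (H0 : 0 <= Rmax (Rabs (x - u)) (Rabs (y - v))).
{ eapply Rle_trans; [apply Rabs_pos|apply Rmax_l]. }
nra.
Qed.

(** * Squared moduli along real lines *)

Lemma Cmod_sq (z : C) : Cmod z ^ 2 = Re z * Re z + Im z * Im z.
Proof. rewrite Cmod2_alt; ring. Qed.

(** The imaginary part is the real part of the function multiplied by -i. *)
Lemma derivable_along_line_Im (f : C -> C) (z0 d l : C) (t0 : R) :
  is_derive f (z0 + t0 * d)%C l ->
  is_derive (fun t : R => Im (f (z0 + t * d)%C)) t0 (Im (l * d)%C).
Proof.
intros Hf.
assert (H := derivable_along_line _ z0 d _ t0
  (is_derive_Cmult _ _ _ _ _ (is_derive_Cconst (- Ci)%C _) Hf)).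
assert (HCi : forall w, Re (- Ci * w)%C = Im w).
{ intros w; rewrite re_mult; simpl; ring. }
replace (Im (l * d)%C) with (Re ((RtoC 0 * f (z0 + t0 * d) + - Ci * l) * d)%C).
- eapply is_derive_ext; [|exact H]; intros t; apply HCi.
- replace ((RtoC 0 * f (z0 + t0 * d) + - Ci * l) * d)%C with (- Ci * (l * d))%C by ring.
  apply HCi.
Qed.

Lemma is_derive_Cmod_sq_along_line (f : C -> C) (z0 d l : C) (t0 : R) :
  is_derive f (z0 + t0 * d)%C l ->
  is_derive (fun t : R => Cmod (f (z0 + t * d)%C) ^ 2) t0
    (2 * Re (Cconj (f (z0 + t0 * d)%C) * (l * d))%C).
Proof.
intros Hf.
assert (HR := derivable_along_line f z0 d l t0 Hf).
assert (HI := derivable_along_line_Im f z0 d l t0 Hf).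
assert (H := is_derive_plus (V := R_NormedModule) _ _ _ _ _
  (Derive.is_derive_mult _ _ _ _ _ HR HR) (Derive.is_derive_mult _ _ _ _ _ HI HI)).
match type of H with is_derive _ _ ?e => 
 replace (2 * Re (Cconj (f (z0 + t0 * d)%C) * (l * d))%C) with e end.
- eapply is_derive_ext; [|exact H]; intros t; cbv beta.
  rewrite Cmod_sq; reflexivity.
- match goal with |- ?a = ?b => change (@eq R a b) end; unfold plus, Re, Im; simpl; ring.
Qed.

Lemma is_derive_Re_conj_along_line (f g : C -> C) (z0 d e lf lg : C) (t0 : R) :
  is_derive f (z0 + t0 * d)%C lf -> is_derive g (z0 + t0 * d)%C lg ->
  is_derive (fun t : R => 2 * Re (Cconj (f (z0 + t * d)%C) * (g (z0 + t * d)%C * e))%C) t0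
    (2 * Re (Cconj (lf * d) * (g (z0 + t0 * d)%C * e)
             + Cconj (f (z0 + t0 * d)%C) * (lg * d * e))%C).
Proof.
intros Hf Hg0.
assert (Hg := is_derive_Cmult _ _ _ _ _ Hg0 (is_derive_Cconst e _)).
assert (HR := derivable_along_line f z0 d lf t0 Hf).
assert (HI := derivable_along_line_Im f z0 d lf t0 Hf).
assert (GR := derivable_along_line _ z0 d _ t0 Hg).
assert (GI := derivable_along_line_Im _ z0 d _ t0 Hg).
assert (H := is_derive_scal _ _ 2 _ (is_derive_plus (V := R_NormedModule) _ _ _ _ _
  (Derive.is_derive_mult _ _ _ _ _ HR GR) (Derive.is_derive_mult _ _ _ _ _ HI GI))).
match type of H with is_derive _ _ ?e0 =>
 match goal with |- is_derive _ _ ?e1 => replace e1 with e0 end end.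
- eapply is_derive_ext; [|exact H]; intros t.
  match goal with |- ?a = ?b => change (@eq R a b) end; unfold plus, Re, Im; simpl; ring.
- match goal with |- ?a = ?b => change (@eq R a b) end; unfold plus, Re, Im; simpl; ring.
Qed.

Lemma second_derivative_at_max (phi phi1 : R -> R) (l delta : R) :
  0 < delta ->
  (forall t, Rabs t < delta -> is_derive phi t (phi1 t)) ->
  (forall t, Rabs t < delta -> phi t <= phi 0) ->
  is_derive phi1 0 l -> l <= 0.
Proof.
intros Hdelta Hphi Hmax Hl.
apply Rnot_lt_le; intros Hpos.
assert (H0 : phi1 0 = 0).
{ assert (Hd : is_derive phi 0 (phi1 0)) by (apply Hphi; rewrite Rabs_R0; lra).
  apply is_derive_Reals in Hd.
  apply (deriv_maximum phi (- delta) delta 0 (exist _ _ Hd)); try lra.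
  intros x H1 H2; apply Hmax; apply Rabs_def1; lra. }
apply is_derive_Reals in Hl.
destruct (Hl (l / 2)) as [[e He] Hd]; [lra|]; simpl in Hd.
set (s := Rmin e delta / 2).
assert (Hs : 0 < s /\ s < e /\ s < delta).
{ assert (0 < Rmin e delta) by (now apply Rmin_glb_lt).
  pose proof (Rmin_l e delta); pose proof (Rmin_r e delta); unfold s; lra. }
assert (Hpos1 : forall t, 0 < t <= s -> 0 < phi1 t).
{ intros t Ht; specialize (Hd t ltac:(lra)).
  rewrite Rabs_pos_eq, Rplus_0_l, H0, Rminus_0_r in Hd by lra.
  specialize (Hd ltac:(lra)); apply Rabs_def2 in Hd.
  replace (phi1 t) with (phi1 t / t * t) by (field; lra).
  apply Rmult_lt_0_compat; lra. }
destruct (MVT_cor2 phi phi1 0 s) as [c [Heq Hc]]; [lra| |].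
- intros x Hx; apply is_derive_Reals, Hphi; apply Rabs_def1; lra.
- assert (0 < phi1 c) by (apply Hpos1; lra).
  specialize (Hmax s ltac:(apply Rabs_def1; lra)).
  nra.
Qed.

Lemma first_derivative_at_left_max (phi : R -> R) (l delta : R) :
  0 < delta -> is_derive phi 0 l ->
  (forall t, 0 < t < delta -> phi t <= phi 0) -> l <= 0.
Proof.
intros Hdelta Hl Hmax; apply Rnot_lt_le; intros Hpos.
apply is_derive_Reals in Hl.
destruct (Hl l Hpos) as [[e He] Hd]; simpl in Hd.
set (s := Rmin e delta / 2).
assert (Hs : 0 < s /\ s < e /\ s < delta).
{ assert (0 < Rmin e delta) by (now apply Rmin_glb_lt).
  pose proof (Rmin_l e delta); pose proof (Rmin_r e delta); unfold s; lra. }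
specialize (Hd s ltac:(lra)).
rewrite Rabs_pos_eq, Rplus_0_l in Hd by lra.
specialize (Hd ltac:(lra)); apply Rabs_def2 in Hd.
assert (0 < (phi s - phi 0) / s) by lra.
specialize (Hmax s ltac:(lra)).
assert (phi s - phi 0 = (phi s - phi 0) / s * s) by (field; lra).
nra.
Qed.

(** * A maximum principle for first-order operators *)

(** The squared modulus of a holomorphic function is only subharmonic; the term
    with eps > 0 makes the Laplacian strictly positive, which rules out interior
    maxima. *)
Definition penalized (eps : R) (q : C -> C) (z : C) : R := Cmod (q z) ^ 2 + eps * Cmod z ^ 2.

Lemma is_derive_penalized_along_line (eps : R) (q : C -> C) (z0 d l : C) (t0 : R) :
  is_derive q (z0 + t0 * d)%C l ->
  is_derive (fun t : R => penalized eps q (z0 + t * d)%C) t0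
    (2 * Re (Cconj (q (z0 + t0 * d)%C) * (l * d))%C
     + eps * (2 * Re (Cconj (z0 + t0 * d) * d)%C)).
Proof.
intros Hq.
assert (H := is_derive_plus (V := R_NormedModule) _ _ _ _ _
  (is_derive_Cmod_sq_along_line q z0 d l t0 Hq)
  (is_derive_scal _ _ eps _
    (is_derive_Cmod_sq_along_line (fun w => w) z0 d 1 t0 (is_derive_Cid _)))).
rewrite Cmult_1_l in H; exact H.
Qed.

(** Half the second derivative of the penalized square along direction d; it cannot
    be positive at an interior maximum. *)
Lemma second_variation_at_max (eps : R) (q q1 q2 : C -> C) (r : R) (z0 d : C) :
  (forall z, in_disk z -> is_derive q z (q1 z)) ->
  (forall z, in_disk z -> is_derive q1 z (q2 z)) ->
  r < 1 -> Cmod z0 < r -> Cmod d = 1 ->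
  (forall z, Cmod z <= r -> penalized eps q z <= penalized eps q z0) ->
  Cmod (q1 z0) ^ 2 + Re (Cconj (q z0) * (q2 z0 * d * d))%C + eps <= 0.
Proof.
intros Hq Hq1 Hr Hz0 Hd Hmax.
assert (Hz0' : (z0 + 0 * d)%C = z0) by ring.
assert (Hball : forall t, Rabs t < r - Cmod z0 -> Cmod (z0 + t * d)%C < r).
{ intros t Ht; eapply Rle_lt_trans; [apply Cmod_triangle|].
  rewrite Cmod_mult, Cmod_R, Hd; lra. }
assert (Hdisk : forall t, Rabs t < r - Cmod z0 -> in_disk (z0 + t * d)%C).
{ intros t Ht; specialize (Hball t Ht); unfold in_disk; lra. }
assert (H0 : Rabs 0 < r - Cmod z0) by (rewrite Rabs_R0; lra).
assert (Hl := is_derive_plus (V := R_NormedModule) _ _ _ _ _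
  (is_derive_Re_conj_along_line q q1 z0 d d _ _ 0 (Hq _ (Hdisk 0 H0)) (Hq1 _ (Hdisk 0 H0)))
  (is_derive_scal _ _ eps _
    (is_derive_Re_conj_along_line (fun w => w) (fun _ => RtoC 1) z0 d d _ _ 0
      (is_derive_Cid _) (is_derive_Cconst 1 _)))).
apply (second_derivative_at_max
  (fun t => penalized eps q (z0 + t * d)%C) _ _ (r - Cmod z0)) in Hl.
- rewrite Hz0' in Hl.
  assert (Hsq : forall w : C, Re (Cconj (w * d) * (w * d))%C = Cmod w ^ 2).
  { intros w; rewrite Cmult_comm, <- Cmod2_conj, re_RtoC, Cmod_mult, Hd; ring. }
  rewrite !re_plus, !Hsq, Cmod_1 in Hl.
  replace (Cconj z0 * (RtoC 0 * d * d))%C with (RtoC 0) in Hl by ring.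
  rewrite re_RtoC in Hl.
  match type of Hl with ?a <= _ => replace a with
   (2 * (Cmod (q1 z0) ^ 2 + Re (Cconj (q z0) * (q2 z0 * d * d))%C + eps)) in Hl end.
  + lra.
  + unfold plus; simpl; ring.
- lra.
- intros t Ht.
  assert (H := is_derive_penalized_along_line eps q z0 d _ t (Hq _ (Hdisk t Ht))).
  match type of H with is_derive _ _ ?a => match goal with |- is_derive _ _ ?b =>
    replace b with a; [exact H|] end end.
  unfold plus; cbv beta; rewrite Cmult_1_l; reflexivity.
- intros t Ht; rewrite Hz0'; apply Hmax; left; now apply Hball.
Qed.

(** Adding the second variations along 1 and i cancels the terms with q2, because
    i^2 = -1, and leaves |q1|^2 + eps > 0: the Laplacian is positive. *)
Lemma penalized_max_on_circle (eps : R) (q q1 q2 : C -> C) (r : R) (z0 : C) :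
  (forall z, in_disk z -> is_derive q z (q1 z)) ->
  (forall z, in_disk z -> is_derive q1 z (q2 z)) ->
  0 < eps -> r < 1 -> Cmod z0 <= r ->
  (forall z, Cmod z <= r -> penalized eps q z <= penalized eps q z0) ->
  Cmod z0 = r.
Proof.
intros Hq Hq1 Heps Hr [Hz0|Hz0] Hmax; trivial; exfalso.
assert (H1 := second_variation_at_max eps q q1 q2 r z0 1 Hq Hq1 Hr Hz0 Cmod_1 Hmax).
assert (Hi := second_variation_at_max eps q q1 q2 r z0 Ci Hq Hq1 Hr Hz0 Cmod_Ci Hmax).
replace (Cconj (q z0) * (q2 z0 * Ci * Ci))%C
  with (- (Cconj (q z0) * (q2 z0 * 1 * 1)))%C in Hi.
- rewrite re_opp in Hi.
  pose proof (pow2_ge_0 (Cmod (q1 z0))); lra.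
- replace (q2 z0 * Ci * Ci)%C with (- q2 z0)%C; [ring|].
  apply injective_projections; simpl; ring.
Qed.

(** Since Re c > 0, the segment from z0 in the direction - conj(c) z0 starts inside
    the disk of radius |z0|, so the derivative at z0 in that direction is at most 0.
    This replaces Jack's lemma: it yields at once the inequality that is needed,
    without showing that z0 q'(z0) / q(z0) is a nonnegative real. *)
Lemma inward_variation_at_max (eps : R) (q : C -> C) (z0 c l : C) :
  is_derive q z0 l -> 0 < Re c ->
  (forall z, Cmod z <= Cmod z0 -> penalized eps q z <= penalized eps q z0) ->
  0 <= Re (Cconj c * (Cconj (q z0) * (z0 * l)))%C + eps * Cmod z0 ^ 2 * Re c.
Proof.
intros Hq Hc Hmax.
set (d := (- Cconj c * z0)%C).
assert (Hz0' : (z0 + 0 * d)%C = z0) by ring.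
assert (Hl := is_derive_penalized_along_line eps q z0 d l 0
  ltac:(rewrite Hz0'; exact Hq)).
assert (Hc2 : 0 < Cmod c ^ 2).
{ rewrite Cmod_sq; nra. }
apply (first_derivative_at_left_max _ _ (Re c / Cmod c ^ 2)) in Hl.
- rewrite Hz0' in Hl.
  replace (Cconj (q z0) * (l * d))%C
    with (- (Cconj c * (Cconj (q z0) * (z0 * l))))%C in Hl by (unfold d; ring).
  replace (Cconj z0 * d)%C with (- ((Cmod z0 ^ 2)%R * Cconj c))%C in Hl
    by (rewrite Cmod2_conj; unfold d; ring).
  rewrite !re_opp, re_scal_l, re_conj in Hl; lra.
- now apply Rdiv_lt_0_compat.
- intros t [Ht0 Ht]; cbv beta; rewrite Hz0'; apply Hmax.
  replace (z0 + t * d)%C with ((1 - t * Cconj c) * z0)%C by (unfold d; ring).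
  rewrite Cmod_mult.
  (* |1 - t conj(c)|^2 = 1 - 2 t Re c + t^2 |c|^2 <= 1 for these t. *)
  assert (Ht' : t * Cmod c ^ 2 < Re c).
  { apply (Rmult_lt_compat_r (Cmod c ^ 2)) in Ht; trivial.
    unfold Rdiv in Ht; rewrite Rmult_assoc, Rinv_l, Rmult_1_r in Ht by lra; exact Ht. }
  assert (Hsq : Cmod (1 - t * Cconj c)%C ^ 2 = 1 - 2 * t * Re c + t * (t * Cmod c ^ 2)).
  { rewrite !Cmod_sq; unfold Re, Im; simpl; ring. }
  assert (H1 : Cmod (1 - t * Cconj c)%C <= 1).
  { pose proof (Cmod_ge_0 (1 - t * Cconj c)%C). nra. }
  pose proof (Cmod_ge_0 z0); nra.
Qed.

Lemma continuous_penalized (eps : R) (q : C -> C) (z l : C) :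
  is_derive q z l -> continuousC (penalized eps q) z.
Proof.
assert (Hmod : forall w : C, continuous (T := C_UniformSpace) (U := R_UniformSpace) Cmod w).
{ intros w; exact (filterlim_norm (V := C_NormedModule) w). }
assert (Hsq : forall (f : C -> C) l, is_derive f z l -> continuousC (fun w => Cmod (f w) ^ 2) z).
{ intros f l' Hf.
  assert (Hcf := ex_derive_continuous (V := C_NormedModule) f z (ex_intro _ l' Hf)).
  assert (Hpow : continuous (T := R_UniformSpace) (U := R_UniformSpace)
    (fun x : R => x ^ 2) (Cmod (f z))).
  { apply (ex_derive_continuous (V := R_NormedModule)); auto_derive; trivial. }
  exact (continuous_comp (U := AbsRing_UniformSpace C_AbsRing) (V := R_UniformSpace)
    (W := R_UniformSpace) _ _ z
    (continuous_comp (U := AbsRing_UniformSpace C_AbsRing) (V := C_UniformSpace)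
      (W := R_UniformSpace) f Cmod z Hcf (Hmod _)) Hpow). }
intros Hq; unfold penalized.
apply (continuous_plus (U := AbsRing_UniformSpace C_AbsRing) (V := R_NormedModule)).
- exact (Hsq q l Hq).
- apply (continuous_scal_r (U := AbsRing_UniformSpace C_AbsRing) (V := R_NormedModule) eps).
  exact (Hsq (fun w => w) _ (is_derive_Cid z)).
Qed.

(** At a maximum z0 of |q| on |z| <= r, the inward variation says
    Re (conj(c q) z0 q') >= 0, hence |z0 q' + c q| >= |c| |q| at z0; with the penalty
    both hold up to a multiple of eps.  The weight
    |z|^n is what a Schwarz lemma would supply for a function with a zero of order n
    at the origin; it can be divided out because the maximum is reached on the
    circle |z0| = r, and then r tends to 1. *)
Lemma Cmod_bound_of_first_order (n : nat) (q q1 q2 : C -> C) (c : C) (M : R) :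
  0 < Re c ->
  (forall z, in_disk z -> is_derive q z (q1 z)) ->
  (forall z, in_disk z -> is_derive q1 z (q2 z)) ->
  (forall z, in_disk z -> Cmod z ^ n * Cmod (z * q1 z + c * q z)%C <= M) ->
  forall z, in_disk z -> Cmod c * Cmod (q z) <= M.
Proof.
intros Hc Hq Hq1 HM.
assert (HM0 : 0 <= M).
{ eapply Rle_trans; [|apply (HM (RtoC 0)); unfold in_disk; rewrite Cmod_0; lra].
  apply Rmult_le_pos; [apply pow_le|]; apply Cmod_ge_0. }
assert (Hcpos : 0 <= Cmod c) by apply Cmod_ge_0.
assert (Heps : forall eps r z, 0 < eps -> 0 < r < 1 -> Cmod z <= r ->
  (r ^ n * (Cmod c * Cmod (q z))) ^ 2 <= M ^ 2 + eps * (2 * Re c + Cmod c ^ 2)).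
{ intros eps r z Heps Hr Hz.
  destruct (max_on_closed_disk (penalized eps q) r) as [z0 [Hz0 Hmax]]; [lra| |].
  { intros w Hw; apply (continuous_penalized eps q w (q1 w)), Hq; unfold in_disk; lra. }
  assert (Hz0r := penalized_max_on_circle eps q q1 q2 r z0 Hq Hq1 Heps (proj2 Hr) Hz0 Hmax).
  assert (Hin : in_disk z0) by (unfold in_disk; lra).
  assert (Hvar := inward_variation_at_max eps q z0 c (q1 z0) (Hq z0 Hin) Hc
    ltac:(rewrite Hz0r; exact Hmax)).
  specialize (HM z0 Hin); specialize (Hmax z Hz); unfold penalized in Hmax.
  rewrite Hz0r in HM, Hvar, Hmax.
  assert (Hexp : Cmod (z0 * q1 z0 + c * q z0)%C ^ 2 =
    Cmod (z0 * q1 z0)%C ^ 2 + 2 * Re (Cconj c * (Cconj (q z0) * (z0 * q1 z0)))%C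
    + (Cmod c * Cmod (q z0)) ^ 2).
  { rewrite Rpow_mult_distr, !Cmod_sq; unfold Re, Im; simpl; ring. }
  set (h := Cmod (z0 * q1 z0 + c * q z0)%C) in *.
  assert (Hh : 0 <= h) by apply Cmod_ge_0.
  assert (Hrn : 0 < r ^ n <= 1).
  { split; [apply pow_lt; lra|]. rewrite <- (pow1 n); apply pow_incr; lra. }
  assert (HhM : (r ^ n * h) ^ 2 <= M ^ 2).
  { apply pow_incr; split; [apply Rmult_le_pos; lra|exact HM]. }
  assert (Hc2 : 0 <= Cmod c ^ 2) by apply pow2_ge_0.
  assert (Hr2 : 0 <= r ^ 2 <= 1) by nra.
  assert (Hstep : (Cmod c * Cmod (q z)) ^ 2 <= h ^ 2 + eps * (2 * Re c + Cmod c ^ 2)).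
  { assert (Hqz : Cmod (q z) ^ 2 <= Cmod (q z0) ^ 2 + eps).
    { pose proof (pow2_ge_0 (Cmod z)); nra. }
    assert (H1 : Cmod c ^ 2 * Cmod (q z) ^ 2 <= Cmod c ^ 2 * (Cmod (q z0) ^ 2 + eps)).
    { now apply Rmult_le_compat_l. }
    assert (H2 : eps * r ^ 2 * Re c <= eps * Re c).
    { assert (0 <= eps * Re c) by nra. nra. }
    pose proof (pow2_ge_0 (Cmod (z0 * q1 z0)%C)).
    rewrite Rpow_mult_distr in *; lra. }
  rewrite Rpow_mult_distr in *.
  assert (Hrn2 : 0 <= (r ^ n) ^ 2 <= 1).
  { split; [apply pow2_ge_0|]. nra. }
  assert (0 <= eps * (2 * Re c + Cmod c ^ 2)) by (apply Rmult_le_pos; lra).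
  nra. }
(* Let eps tend to 0. *)
assert (Hr : forall r z, 0 < r < 1 -> Cmod z <= r ->
  r ^ n * (Cmod c * Cmod (q z)) <= M).
{ intros r z Hr Hz; apply Rnot_lt_le; intros Hlt.
  set (X := r ^ n * (Cmod c * Cmod (q z))) in *.
  assert (HK : 0 < 2 * Re c + Cmod c ^ 2) by (pose proof (pow2_ge_0 (Cmod c)); lra).
  assert (Hgap : 0 < (X ^ 2 - M ^ 2) / 2 / (2 * Re c + Cmod c ^ 2)).
  { apply Rdiv_lt_0_compat; [nra|trivial]. }
  specialize (Heps _ r z Hgap Hr Hz); fold X in Heps.
  replace ((X ^ 2 - M ^ 2) / 2 / (2 * Re c + Cmod c ^ 2) * (2 * Re c + Cmod c ^ 2))
    with ((X ^ 2 - M ^ 2) / 2) in Heps by (field; lra).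
  nra. }
(* Let r tend to 1. *)
intros z Hz; unfold in_disk in Hz.
set (X := Cmod c * Cmod (q z)).
assert (Hlim : is_lim (fun r => r ^ n * X) 1 (1 * X)).
{ assert (Hcont : continuity_pt (fun r => r ^ n * X) 1) by reg.
  replace (1 * X) with (1 ^ n * X) by (rewrite pow1; ring).
  exact (is_lim_continuity (fun r => r ^ n * X) 1 Hcont). }
rewrite Rmult_1_l in Hlim.
apply (filterlim_le (F := at_left 1) (fun r => r ^ n * X) (fun _ => M) X M).
- assert (Hmax : Rmax (Cmod z) (1 / 2) < 1) by (apply Rmax_lub_lt; lra).
  assert (Hgap : 0 < 1 - Rmax (Cmod z) (1 / 2)) by lra.
  exists (mkposreal _ Hgap); intros r Hr1 Hr2.
  apply Rabs_def2 in Hr1; simpl in Hr1; unfold minus, plus, opp in Hr1; simpl in Hr1.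
  pose proof (Rmax_l (Cmod z) (1 / 2)); pose proof (Rmax_r (Cmod z) (1 / 2)).
  apply Hr; lra.
- eapply filterlim_filter_le_1; [|exact Hlim].
  intros P [d Hd]; exists d; intros r H1 H2; apply Hd; trivial; lra.
- apply filterlim_const.
Qed.

(** * Complex power series on the unit disk *)

(** The radius of convergence of a complex series is that of its real series of
    moduli, so real results on radii apply. *)
Definition unit_radius (a : nat -> C) : Prop := Rbar_le 1 (CV_radius (fun k => Cmod (a k))).

Definition expands (a : nat -> C) (f : C -> C) : Prop :=
  forall z, in_disk z -> is_pseries (V := C_NormedModule) a z (f z).

Definition coef_derive (a : nat -> C) (k : nat) : C := (RtoC (INR (S k)) * a (S k))%C.

Lemma pow_n_C (z : C) (k : nat) : pow_n (K := C_Ring) z k = (z ^ k)%C.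
Proof. induction k as [|k IH]; [reflexivity|]. change (z * pow_n (K := C_Ring) z k = z * z ^ k)%C; now rewrite IH. Qed.

Lemma expands_series (a : nat -> C) (f : C -> C) :
  expands a f <->
  forall z, in_disk z -> is_series (V := C_NormedModule) (fun k => z ^ k * a k)%C (f z).
Proof.
split; intros H z Hz; (eapply is_series_ext; [|exact (H z Hz)]); intros k;
  [|symmetry]; now rewrite <- pow_n_C.
Qed.

(** A series converging at the real point r has bounded terms there, so its radius
    is at least r; take r < 1 beyond a supposed smaller radius. *)
Lemma unit_radius_of_expands (a : nat -> C) (f : C -> C) : expands a f -> unit_radius a.
Proof.
intros Ha; unfold unit_radius.
apply Rbar_not_lt_le; intros Hlt.
destruct (CV_radius_bounded (fun k => Cmod (a k))) as [Hub _].
assert (H0 := CV_radius_ge_0 (fun k => Cmod (a k))).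
set (R0 := CV_radius (fun k => Cmod (a k))) in *.
destruct R0 as [R1| |]; simpl in Hlt, H0; try easy.
set (r := (R1 + 1) / 2).
assert (Hr : R1 < r < 1) by (unfold r; lra).
assert (Hz : in_disk r) by (unfold in_disk; rewrite Cmod_R, Rabs_pos_eq; lra).
assert (Hs := proj1 (expands_series a f) Ha r Hz).
destruct (filterlim_bounded (V := C_NormedModule) _ (ex_intro _ _ Hs)) as [B HB].
specialize (Hub r); simpl in Hub.
apply (Rlt_not_le r R1); [lra|].
apply Hub; exists (B + B); intros k.
replace (Rabs (Cmod (a k) * r ^ k)) with (Cmod (r ^ k * a k)%C).
2:{ rewrite Cmod_mult, <- RtoC_pow, Cmod_R, Rabs_mult, (Rabs_pos_eq (Cmod (a k)));
    [ring | apply Cmod_ge_0]. }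
pose proof (HB 0%nat) as HB0; rewrite sum_O in HB0.
change (Cmod (r ^ 0 * a 0%nat)%C <= B) in HB0.
assert (HBpos := Cmod_ge_0 (r ^ 0 * a 0%nat)%C).
destruct k as [|k]; [lra|].
pose proof (HB (S k)) as HBS; rewrite sum_Sn in HBS.
specialize (HB k).
set (s := sum_n (G := C_AbelianGroup) (fun k => r ^ k * a k)%C k).
change (Cmod s <= B) in HB.
change (Cmod (s + r ^ S k * a (S k))%C <= B) in HBS.
replace (r ^ S k * a (S k))%C with ((s + r ^ S k * a (S k)) + - s)%C by ring.
eapply Rle_trans; [apply Cmod_triangle | rewrite Cmod_opp; lra].
Qed.

Lemma unit_radius_derive (a : nat -> C) : unit_radius a -> unit_radius (coef_derive a).
Proof.
unfold unit_radius; intros Ha.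
rewrite <- CV_radius_derive in Ha.
rewrite (CV_radius_ext _ (PS_derive (fun k => Cmod (a k)))); trivial.
intros k; unfold coef_derive, PS_derive.
rewrite Cmod_mult, Cmod_R, Rabs_pos_eq; [reflexivity | apply pos_INR].
Qed.

Lemma unit_radius_shift (a : nat -> C) (n : nat) :
  unit_radius a -> unit_radius (fun k => a (n + k)%nat).
Proof.
induction n as [|n IH]; intros Ha; [exact Ha|].
specialize (IH Ha); unfold unit_radius in *.
rewrite <- CV_radius_decr_1 in IH.
rewrite (CV_radius_ext _ (PS_decr_1 (fun k => Cmod (a (n + k)%nat)))); trivial.
intros k; unfold PS_decr_1; now rewrite Nat.add_succ_r.
Qed.

Lemma ex_series_Cmod (a : nat -> C) (r : R) :
  unit_radius a -> 0 <= r < 1 -> ex_series (fun k => Cmod (a k) * r ^ k).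
Proof.
intros Ha Hr.
eapply ex_series_ext; [|apply (CV_disk_inside (fun k => Cmod (a k)) r)].
- intros k; apply Rabs_pos_eq; apply Rmult_le_pos; [apply Cmod_ge_0 | now apply pow_le].
- rewrite Rabs_pos_eq by lra.
  eapply Rbar_lt_le_trans; [|exact Ha]; simpl; lra.
Qed.

(** Absolute convergence and completeness of C. *)
Lemma expands_of_unit_radius (a : nat -> C) : unit_radius a -> exists f, expands a f.
Proof.
intros Ha.
exists (fun z => iota (T := C_CompleteNormedModule) (fun l => is_pseries (V := C_NormedModule) a z l)).
intros z Hz.
assert (Hex : ex_pseries (V := C_NormedModule) a z).
{ eapply (ex_series_le (V := C_CompleteNormedModule)); [|apply (ex_series_Cmod a (Cmod z) Ha)].
  - intros k; rewrite pow_n_C.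
    change (Cmod (z ^ k * a k)%C <= Cmod (a k) * Cmod z ^ k).
    rewrite Cmod_mult, Cmod_pow; lra.
  - split; [apply Cmod_ge_0 | exact Hz]. }
destruct Hex as [l Hl].
rewrite (iota_unique (V := C_CompleteNormedModule) _ l); trivial.
intros y Hy.
exact (filterlim_locally_unique (V := C_NormedModule) _ _ _ Hy Hl).
Qed.

Lemma Cmod_series_le (c : nat -> C) (b : nat -> R) (l : C) (L : R) :
  is_series (V := C_NormedModule) c l -> is_series b L ->
  (forall k, Cmod (c k) <= b k) -> Cmod l <= L.
Proof.
intros Hc Hb Hle.
assert (Hn : filterlim (fun N => Cmod (sum_n (G := C_AbelianGroup) c N)) eventually (locally (Cmod l))).
{ exact (filterlim_comp _ _ _ _ _ _ _ _ Hc (filterlim_norm (V := C_NormedModule) l)). }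
apply (filterlim_le (F := eventually) _ _ (Cmod l) L) with (2 := Hn) (3 := Hb).
exists 0%nat; intros N _.
eapply Rle_trans; [exact (norm_sum_n_m (V := C_NormedModule) c 0 N)|].
apply sum_n_m_le; exact Hle.
Qed.

(** Second-order Taylor remainder E of the power function; it obeys
    E_(k+1) = w E_k + k z^(k-1) (w - z)^2, which gives the bound by induction. *)
Lemma pow_second_difference (w z : C) (rho : R) (j : nat) :
  Cmod w <= rho -> Cmod z <= rho ->
  Cmod (w ^ S (S j) - z ^ S (S j) - (w - z) * (INR (S (S j)) * z ^ S j))%C
  <= INR (S j) * INR (S (S j)) * rho ^ j * Cmod (w - z)%C ^ 2.
Proof.
intros Hw Hz.
assert (Hrho : 0 <= rho) by (pose proof (Cmod_ge_0 w); lra).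
assert (Hd := pow2_ge_0 (Cmod (w - z)%C)).
induction j as [|j IH].
- replace (w ^ 2 - z ^ 2 - (w - z) * (INR 2 * z ^ 1))%C with ((w - z) ^ 2)%C.
  + rewrite Cmod_pow; simpl; nra.
  + replace (RtoC (INR 2)) with (RtoC 2) by (f_equal; simpl; ring). simpl; ring.
- set (E := (w ^ S (S j) - z ^ S (S j) - (w - z) * (INR (S (S j)) * z ^ S j))%C) in *.
  replace (w ^ S (S (S j)) - z ^ S (S (S j)) - (w - z) * (INR (S (S (S j))) * z ^ S (S j)))%C
    with (w * E + INR (S (S j)) * z ^ S j * (w - z) ^ 2)%C.
  + eapply Rle_trans; [apply Cmod_triangle|].
    rewrite !Cmod_mult, !Cmod_pow, Cmod_R, Rabs_pos_eq by apply pos_INR.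
    assert (H1 : Cmod w * Cmod E <= rho * (INR (S j) * INR (S (S j)) * rho ^ j * Cmod (w - z)%C ^ 2)).
    { apply Rmult_le_compat; trivial; apply Cmod_ge_0. }
    assert (H2 : Cmod z ^ S j <= rho ^ S j).
    { apply pow_incr; split; [apply Cmod_ge_0 | exact Hz]. }
    assert (H3 : INR (S (S j)) * Cmod z ^ S j * Cmod (w - z)%C ^ 2
      <= INR (S (S j)) * rho ^ S j * Cmod (w - z)%C ^ 2).
    { apply Rmult_le_compat_r; trivial; apply Rmult_le_compat_l; trivial; apply pos_INR. }
    assert (H4 : 0 <= rho ^ S j * Cmod (w - z)%C ^ 2).
    { apply Rmult_le_pos; trivial; now apply pow_le. }
    assert (H5 := pos_INR j).
    eapply Rle_trans; [exact (Rplus_le_compat _ _ _ _ H1 H3)|].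
    rewrite !S_INR; set (X := rho ^ S j * Cmod (w - z)%C ^ 2) in *.
    apply Rle_trans with ((INR j + 2) * (INR j + 2) * X); [right; unfold X; simpl; ring|].
    apply Rle_trans with ((INR j + 2) * (INR j + 3) * X); [|right; unfold X; simpl; ring].
    apply Rmult_le_compat_r; trivial; nra.
  + unfold E; rewrite (S_INR (S (S j))), RtoC_plus; rewrite !(Cpow_S w (S (S j))), !(Cpow_S z (S (S j))).
    simpl Cpow; ring.
Qed.

Lemma is_series_C_tail (c : nat -> C) (l : C) :
  c 0%nat = RtoC 0 -> is_series (V := C_NormedModule) c l ->
  is_series (V := C_NormedModule) (fun k => c (S k)) l.
Proof.
intros H0 H; apply is_series_incr_1; rewrite H0.
change (is_series (V := C_NormedModule) c (l + RtoC 0)%C).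
now rewrite Cplus_0_r.
Qed.

Lemma is_series_C_lin (b c : nat -> C) (lb lc x : C) :
  is_series (V := C_NormedModule) b lb -> is_series (V := C_NormedModule) c lc ->
  is_series (V := C_NormedModule) (fun k => b k - x * c k)%C (lb - x * lc)%C.
Proof.
intros Hb Hc.
exact (is_series_minus (V := C_NormedModule) _ _ _ _ Hb
  (is_series_scal (V := C_NormedModule) x _ _ Hc)).
Qed.

(** Multiplying the remainders of the powers by the coefficients and summing gives
    a remainder of f bounded by |w - z|^2 times the sum of the series of second
    derivatives of the moduli, on a disk of radius rho < 1. *)
Lemma is_derive_expands (a : nat -> C) (f g : C -> C) :
  expands a f -> expands (coef_derive a) g ->
  forall z, in_disk z -> is_derive f z (g z).
Proof.
intros Hf Hg z Hz; unfold in_disk in Hz.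
assert (Hrad := unit_radius_derive _ (unit_radius_derive _ (unit_radius_of_expands _ _ Hf))).
set (rho := (1 + Cmod z) / 2).
assert (Hz0 := Cmod_ge_0 z).
assert (Hrho : Cmod z < rho < 1) by (unfold rho; lra).
destruct (ex_series_Cmod _ rho Hrad) as [K HK]; [lra|].
assert (HK0 := Rabs_pos K).
assert (Hquad : forall w, Cmod w <= rho ->
  Cmod (f w - f z - (w - z) * g z)%C <= Rabs K * Cmod (w - z)%C ^ 2).
{ intros w Hw.
  assert (Hfw := proj1 (expands_series _ _) Hf w ltac:(unfold in_disk; lra)).
  assert (Hfz := proj1 (expands_series _ _) Hf z Hz).
  assert (Hgz := proj1 (expands_series _ _) Hg z Hz).
  (* The remainder terms of degree 0 and 1 vanish; dropping them aligns the
     series with the one of second derivatives. *)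
  assert (Hd := is_series_C_lin _ _ _ _ 1 Hfw Hfz).
  apply is_series_C_tail in Hd; [|simpl; ring].
  assert (He := is_series_C_lin _ _ _ _ (w - z)%C Hd Hgz).
  apply is_series_C_tail in He; [|unfold coef_derive; simpl; ring].
  rewrite Cmult_1_l in He.
  assert (HKs := is_series_scal_r (Cmod (w - z)%C ^ 2) _ _ HK).
  eapply Rle_trans; [apply (Cmod_series_le _ _ _ _ He HKs)|].
  - intros k; cbv beta.
    assert (Hp := pow_second_difference w z rho k Hw ltac:(lra)).
    replace (w ^ S (S k) * a (S (S k)) - 1 * (z ^ S (S k) * a (S (S k)))
      - (w - z) * (z ^ S k * coef_derive a (S k)))%C
      with (a (S (S k)) * (w ^ S (S k) - z ^ S (S k) - (w - z) * (INR (S (S k)) * z ^ S k)))%C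
      by (unfold coef_derive; ring).
    unfold coef_derive; rewrite !Cmod_mult, !Cmod_R, !Rabs_pos_eq by apply pos_INR.
    replace (INR (S k) * (INR (S (S k)) * Cmod (a (S (S k)))) * rho ^ k * Cmod (w - z)%C ^ 2)
      with (Cmod (a (S (S k))) * (INR (S k) * INR (S (S k)) * rho ^ k * Cmod (w - z)%C ^ 2)) by ring.
    apply Rmult_le_compat_l; [apply Cmod_ge_0 | exact Hp].
  - apply Rmult_le_compat_r; [apply pow2_ge_0 | apply Rle_abs]. }
apply is_derive_C_eps; intros eps.
assert (He : 0 < Rmin (rho - Cmod z) (eps / (Rabs K + 1))).
{ apply Rmin_glb_lt; [lra|]. apply Rdiv_lt_0_compat; [apply cond_pos|lra]. }
exists (mkposreal _ He); intros w Hw; simpl in Hw.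
assert (H1 : Cmod (w - z)%C < rho - Cmod z).
{ eapply Rlt_le_trans; [exact Hw | apply Rmin_l]. }
assert (H2 : Cmod (w - z)%C < eps / (Rabs K + 1)).
{ eapply Rlt_le_trans; [exact Hw | apply Rmin_r]. }
eapply Rle_trans; [apply Hquad|].
- replace w with ((w - z) + z)%C by ring.
  eapply Rle_trans; [apply Cmod_triangle | lra].
- apply (Rmult_lt_compat_r (Rabs K + 1)) in H2; [|lra].
  unfold Rdiv in H2; rewrite Rmult_assoc, Rinv_l, Rmult_1_r in H2 by lra.
  pose proof (Cmod_ge_0 (w - z)%C); nra.
Qed.

Lemma ex_expands_derive (a : nat -> C) (f : C -> C) : expands a f ->
  exists g, expands (coef_derive a) g /\ forall z, in_disk z -> is_derive f z (g z).
Proof.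
intros Hf.
destruct (expands_of_unit_radius _ (unit_radius_derive _ (unit_radius_of_expands _ _ Hf))) as [g Hg].
exists g; split; trivial; exact (is_derive_expands a f g Hf Hg).
Qed.

(** The coefficients of degree 2 to n vanish, so everything above degree 1 is
    divisible by z^(n+1); G collects the quotient. *)
Lemma class_A_factor (n : nat) (f : C -> C) : (1 <= n)%nat -> class_A n f ->
  exists b G, expands b G /\
    forall z, in_disk z -> f z = (z * (1 + z ^ n * G z))%C.
Proof.
intros Hn [_ [a [Ha0 [Ha1 [Han Hf]]]]].
change (expands a f) in Hf.
assert (Hrad := unit_radius_shift a (S n) (unit_radius_of_expands _ _ Hf)).
destruct (expands_of_unit_radius _ Hrad) as [G HG].
exists (fun k => a (S n + k)%nat), G; split; trivial.
intros z Hz.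
assert (Hs := proj1 (expands_series _ _) Hf z Hz).
assert (HGs := proj1 (expands_series _ _) HG z Hz).
assert (Hhead : forall m, (1 <= m <= n)%nat ->
  sum_n (G := C_AbelianGroup) (fun k => z ^ k * a k)%C m = z).
{ induction m as [|m IH]; intros Hm; [lia|].
  rewrite sum_Sn; destruct m as [|m].
  - rewrite sum_O, Ha0, Ha1.
    change (z ^ 0 * 0 + z ^ 1 * 1 = z)%C; simpl; ring.
  - rewrite IH, (Han (S (S m))) by lia.
    change (z + z ^ S (S m) * 0 = z)%C; ring. }
assert (Htail : is_series (V := C_NormedModule)
  (fun k => z ^ (S n + k) * a (S n + k)%nat)%C (f z - z)%C).
{ apply (is_series_incr_n (V := C_NormedModule) (fun k => z ^ k * a k)%C (S n)); [lia|].
  simpl pred; rewrite Hhead by lia.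
  change (is_series (V := C_NormedModule) (fun k => z ^ k * a k)%C (f z - z + z)%C).
  replace (f z - z + z)%C with (f z) by ring; exact Hs. }
assert (Hscal : is_series (V := C_NormedModule)
  (fun k => z ^ (S n + k) * a (S n + k)%nat)%C (z ^ S n * G z)%C).
{ eapply is_series_ext; [|exact (is_series_scal (V := C_NormedModule) (z ^ S n)%C _ _ HGs)].
  intros k; cbv beta.
  change (z ^ S n * (z ^ k * a (S n + k)%nat) = z ^ (S n + k) * a (S n + k)%nat)%C.
  rewrite Cpow_add_r; ring. }
assert (Heq : (f z - z = z ^ S n * G z)%C).
{ exact (filterlim_locally_unique (V := C_NormedModule) _ _ _ Htail Hscal). }
replace (f z) with (f z - z + z)%C by ring; rewrite Heq, Cpow_S; ring.
Qed.

(** * Starlikeness *)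

Lemma C_derive_on_disk (f g : C -> C) (l z : C) :
  in_disk z -> (forall w, in_disk w -> f w = g w) -> is_derive g z l -> C_derive f z = l.
Proof.
intros Hz Heq Hg; apply is_C_derive_unique.
apply (is_derive_C_ext_disk g f z l Hz); trivial.
intros w Hw; symmetry; auto.
Qed.

Lemma is_derive_pow_mul (k : nat) (g : C -> C) (z dg : C) :
  is_derive g z dg ->
  is_derive (fun w => w ^ S k * g w)%C z (INR (S k) * z ^ k * g z + z ^ S k * dg)%C.
Proof. intros Hg; exact (is_derive_Cmult _ _ z _ _ (is_derive_Cpow (S k) z) Hg). Qed.

(** The form c g + z g' is stable under differentiation, with c + 1 in place of c;
    so the derivatives of q are explicit in those of G. *)
Lemma is_derive_euler (c : C) (g g1 : C -> C) (z g2 : C) :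
  is_derive g z (g1 z) -> is_derive g1 z g2 ->
  is_derive (fun w => c * g w + w * g1 w)%C z ((c + 1) * g1 z + z * g2)%C.
Proof.
intros Hg Hg1.
replace ((c + 1) * g1 z + z * g2)%C
  with ((RtoC 0 * g z + c * g1 z) + (1 * g1 z + z * g2))%C by ring.
exact (is_derive_Cplus _ _ _ _ _
  (is_derive_Cmult _ _ _ _ _ (is_derive_Cconst c z) Hg)
  (is_derive_Cmult _ _ _ _ _ (is_derive_Cid z) Hg1)).
Qed.

(** With F = 1 + z^n G and q = n G + z G', these are f' = F + z F' where
    z F' = z^n q, and z f'' - n (f' - F) = z^n (z q' + q). *)
Lemma class_A_formulas (n : nat) (f G G1 G2 : C -> C) :
  (1 <= n)%nat ->
  (forall z, in_disk z -> f z = (z * (1 + z ^ n * G z))%C) ->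
  (forall z, in_disk z -> is_derive G z (G1 z)) ->
  (forall z, in_disk z -> is_derive G1 z (G2 z)) ->
  forall z, in_disk z ->
  (C_derive f z = (1 + z ^ n * G z) + z ^ n * (INR n * G z + z * G1 z))%C /\
  (z * C_derive (C_derive f) z - INR n * (C_derive f z - (1 + z ^ n * G z))
   = z ^ n * (z * ((INR n + 1) * G1 z + z * G2 z) + (INR n * G z + z * G1 z)))%C.
Proof.
intros Hn Hf HG HG1.
destruct n as [|m]; [lia|].
set (n := S m) in *.
assert (Hf1 : forall z, in_disk z ->
  (C_derive f z = (1 + z ^ n * G z) + z ^ n * (INR n * G z + z * G1 z))%C).
{ intros z Hz.
  apply (C_derive_on_disk f (fun w => w + w ^ S n * G w)%C); trivial.
  - intros w Hw; rewrite Hf, Cpow_S by trivial; ring.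
  - assert (H := is_derive_Cplus _ _ _ _ _ (is_derive_Cid z)
      (is_derive_pow_mul n G z _ (HG z Hz))).
    match type of H with is_derive _ _ ?a => match goal with |- is_derive _ _ ?b =>
      replace b with a; [exact H|] end end.
    rewrite S_INR, RtoC_plus, Cpow_S; ring. }
intros z Hz; split; [now apply Hf1|].
rewrite (Hf1 z Hz).
assert (H := is_derive_Cplus _ _ _ _ _
  (is_derive_Cplus _ _ _ _ _ (is_derive_Cconst 1 z) (is_derive_pow_mul m G z _ (HG z Hz)))
  (is_derive_pow_mul m _ z _ (is_derive_euler (INR n) G G1 z _ (HG z Hz) (HG1 z Hz)))).
fold n in H.
rewrite (C_derive_on_disk _ _ _ _ Hz Hf1 H).
unfold n; rewrite Cpow_S; ring.
Qed.

(** The bounds on u and p fit together: |F| > 1 - (1 - alpha) / (n + 1 - alpha)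
    = n / (n + 1 - alpha), strictly because |z|^n < 1. *)
Lemma quotient_bound (n : nat) (alpha : R) (F p u : C) (z : C) :
  (1 <= n)%nat -> 0 <= alpha < 1 -> in_disk z ->
  (F = 1 + z ^ n * u)%C ->
  Cmod u <= (1 - alpha) / (INR n + 1 - alpha) ->
  Cmod p <= (1 - alpha) * INR n / (INR n + 1 - alpha) ->
  F <> RtoC 0 /\ Cmod (p / F)%C < 1 - alpha.
Proof.
intros Hn Ha Hz HF Hu Hp; unfold in_disk in Hz.
assert (Hn1 : 1 <= INR n) by (apply (le_INR 1); trivial).
set (D := INR n + 1 - alpha) in *.
assert (HD : 0 < D) by (unfold D; lra).
assert (Hk : 0 < (1 - alpha) / D) by (apply Rdiv_lt_0_compat; lra).
assert (Hzn : Cmod z ^ n < 1).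
{ destruct n as [|m]; [lia|]; simpl.
  assert (Cmod z ^ m <= 1) by (rewrite <- (pow1 m); apply pow_incr; pose proof (Cmod_ge_0 z); lra).
  assert (0 <= Cmod z ^ m) by (apply pow_le, Cmod_ge_0).
  pose proof (Cmod_ge_0 z); nra. }
assert (Hsmall : Cmod (z ^ n * u)%C < (1 - alpha) / D).
{ rewrite Cmod_mult, Cmod_pow.
  assert (0 <= Cmod z ^ n) by (apply pow_le, Cmod_ge_0).
  pose proof (Cmod_ge_0 u); nra. }
assert (HFlow : INR n / D < Cmod F).
{ assert (Htri := Cmod_triangle F (- (z ^ n * u))%C).
  replace (F + - (z ^ n * u))%C with (RtoC 1) in Htri by (rewrite HF; ring).
  rewrite Cmod_1, Cmod_opp in Htri.
  replace (INR n / D) with (1 - (1 - alpha) / D) by (unfold D in *; field; lra).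
  lra. }
assert (HnD : 0 < INR n / D) by (apply Rdiv_lt_0_compat; lra).
assert (HF0 : F <> RtoC 0) by (apply Cmod_gt_0; lra).
split; trivial.
rewrite Cmod_div by trivial.
apply Rmult_lt_reg_r with (Cmod F); [lra|].
unfold Rdiv at 1; rewrite Rmult_assoc, Rinv_l, Rmult_1_r by lra.
eapply Rle_lt_trans; [exact Hp|].
replace ((1 - alpha) * INR n / D) with ((1 - alpha) * (INR n / D)) by (field; lra).
apply Rmult_lt_compat_l; lra.
Qed.

Theorem theorem1 (n : nat) (f : C -> C) (alpha : R) (beta : C)
  (hn : (1 <= n)%nat)
  (hf : class_A n f)
  (halpha : 0 <= alpha < 1)
  (hbeta : Re beta < INR n + 1)
  (hbound : forall z : C, in_disk z ->
     Cmod (z * C_derive (C_derive f) z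
           - beta * (C_derive f z - quot_id f z))%C
     < (1 - alpha) * INR n * Cmod (RtoC (INR n + 1) - beta)%C
       / (INR n + 1 - alpha)) :
  quot_log_defined f /\
  (forall z : C, in_disk z -> Cmod (quot_log f z - RtoC 1)%C < 1 - alpha) /\
  starlike n alpha f.
Proof.
destruct (class_A_factor n f hn hf) as [b [G [HbG Hf]]].
destruct (ex_expands_derive b G HbG) as [G1 [HbG1 HG]].
destruct (ex_expands_derive _ G1 HbG1) as [G2 [HbG2 HG1]].
destruct (ex_expands_derive _ G2 HbG2) as [G3 [_ HG2]].
assert (Hn1 : 1 <= INR n) by (apply (le_INR 1); trivial).
set (q := fun z => (INR n * G z + z * G1 z)%C).
set (c := (RtoC (INR n + 1) - beta)%C) in *.
set (D := INR n + 1 - alpha) in *.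
assert (HD : 0 < D) by (unfold D; lra).
assert (Hform := class_A_formulas n f G G1 G2 hn Hf HG HG1).
assert (Hid : forall z, in_disk z -> quot_id f z = (1 + z ^ n * G z)%C).
{ intros z Hz; unfold quot_id; destruct (Ceq_dec z 0) as [->|Hz0].
  - destruct n as [|m]; [lia|]; rewrite Cpow_S; ring.
  - rewrite Hf by trivial; now field. }
assert (Hc : 0 < Re c).
{ unfold c, Cminus; rewrite re_plus, re_opp, re_RtoC; lra. }
assert (Hc0 : 0 < Cmod c).
{ eapply Rlt_le_trans; [exact Hc|]. eapply Rle_trans; [apply Rle_abs | apply re_le_Cmod]. }
assert (Hq : forall z, in_disk z -> Cmod (q z) <= (1 - alpha) * INR n / D).
{ intros z Hz.
  apply Rmult_le_reg_l with (Cmod c); trivial.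
  replace (Cmod c * ((1 - alpha) * INR n / D)) with ((1 - alpha) * INR n * Cmod c / D)
    by (field; lra).
  revert z Hz.
  apply (Cmod_bound_of_first_order n q
    (fun z => (INR n + 1) * G1 z + z * G2 z)%C
    (fun z => (INR n + 1 + 1) * G2 z + z * G3 z)%C c); trivial.
  - intros z Hz; apply is_derive_euler; auto.
  - intros z Hz; apply is_derive_euler; auto.
  - (* (n - beta) z^n q completes the formula for z f'' - n (f' - F) to
       z f'' - beta (f' - F), so that n + 1 - beta appears in front of q. *)
    intros z Hz; left.
    eapply Rle_lt_trans; [right|exact (hbound z Hz)].
    rewrite <- Cmod_pow, <- Cmod_mult; f_equal.
    destruct (Hform z Hz) as [H1 H2].
    rewrite (Hid z Hz).
    replace (z * C_derive (C_derive f) z - beta * (C_derive f z - (1 + z ^ n * G z)))%C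
      with (z * C_derive (C_derive f) z - INR n * (C_derive f z - (1 + z ^ n * G z))
            + (INR n - beta) * (C_derive f z - (1 + z ^ n * G z)))%C by ring.
    rewrite H2, H1; unfold c, q; rewrite RtoC_plus; ring. }
assert (HGb : forall z, in_disk z -> Cmod (G z) <= (1 - alpha) / D).
{ intros z Hz.
  apply Rmult_le_reg_l with (INR n); [lra|].
  replace (INR n * ((1 - alpha) / D)) with ((1 - alpha) * INR n / D) by (field; lra).
  replace (INR n) with (Cmod (RtoC (INR n))) at 1
    by (rewrite Cmod_R; apply Rabs_pos_eq; lra).
  revert z Hz.
  apply (Cmod_bound_of_first_order 0 G G1 G2); trivial.
  - rewrite re_RtoC; lra.
  - intros z Hz; rewrite pow_O, Rmult_1_l, Cplus_comm; exact (Hq z Hz). }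
assert (Hmain : forall z, in_disk z ->
  (1 + z ^ n * G z)%C <> RtoC 0 /\
  Cmod (z ^ n * q z / (1 + z ^ n * G z))%C < 1 - alpha).
{ intros z Hz; apply (quotient_bound n alpha _ _ (G z) z); auto.
  rewrite Cmod_mult, Cmod_pow.
  assert (Cmod z ^ n <= 1).
  { rewrite <- (pow1 n); apply pow_incr; unfold in_disk in Hz; pose proof (Cmod_ge_0 z); lra. }
  pose proof (Cmod_ge_0 (q z)); pose proof (Hq z Hz); fold D; nra. }
assert (Hdef : quot_log_defined f).
{ intros z Hz Hz0; rewrite Hf by trivial; apply Cmult_neq_0; trivial; now apply Hmain. }
assert (Hlog : forall z, in_disk z -> Cmod (quot_log f z - 1)%C < 1 - alpha).
{ intros z Hz; unfold quot_log; destruct (Ceq_dec z 0) as [->|Hz0].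
  - replace (RtoC 1 - RtoC 1)%C with (RtoC 0) by ring; rewrite Cmod_0; lra.
  - destruct (Hmain z Hz) as [HF0 HF].
    replace (z * C_derive f z / f z - 1)%C
      with (z ^ n * q z / (1 + z ^ n * G z))%C; trivial.
    rewrite (proj1 (Hform z Hz)), (Hf z Hz); unfold q; field; split; trivial. }
split; [trivial | split; [trivial|]].
split; [trivial | split; [trivial|]].
intros z Hz; specialize (Hlog z Hz).
assert (Hre := re_le_Cmod (quot_log f z - 1)%C).
unfold Cminus in Hre at 1; rewrite re_plus, re_opp, re_RtoC in Hre.
assert (Hlt := Rle_lt_trans _ _ _ Hre Hlog); apply Rabs_def2 in Hlt; lra.
Qed.
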